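(* Let $\mathfrak{n}$ be the $13$-dimensional real Lie algebra with basis $\{X_1,\dots,X_6,Y_1,Y_2,Y_3,Z_1,Z_2,W_1,W_2\}$ whose only nonzero brackets among basis elements (up to skew-symmetry) are $$[X_1,Y_1]=Z_1,\quad [X_2,Y_2]=Z_2,\quad [X_3,Y_3]=-(Z_1+Z_2),$$ $$[X_4,Y_1]=W_1,\quad [X_5,Y_2]=W_2,\quad [X_6,Y_3]=-(W_1+W_2).$$ Then $\mathfrak{n}$ is a two-step nilpotent Anosov Lie algebra of type $(9,4)$.
   Context: A real Lie algebra of dimension $n$ is called Anosov if it admits a Lie algebra automorphism $\tau$ that is hyperbolic (none of its complex eigenvalues has modulus $1$) and such that the matrix of $\tau$ lies in $\mathrm{GL}_n(\mathbb{Z})$ with respect to some $\mathbb{Z}$-basis, i.e. a basis with integer structure constants. The type of a nilpotent Lie algebra $\mathfrak{n}$ is the tuple $(n_1,\dots,n_r)$ with $n_i=\dim C^{i-1}(\mathfrak{n})/C^i(\mathfrak{n})$, where $C^0(\mathfrak{n})=\mathfrak{n}$, $C^{i}(\mathfrak{n})=[\mathfrak{n},C^{i-1}(\mathfrak{n})]$ is the descending central series, and $C^r(\mathfrak{n})=0\ne C^{r-1}(\mathfrak{n})$. *)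

(* Defs.v *)
From HB Require Import structures.
From mathcomp Require Import all_boot all_order all_algebra.
From mathcomp Require Import complex.

Set Implicit Arguments.
Unset Strict Implicit.
Unset Printing Implicit Defensive.

Import Order.TTheory GRing.Theory Num.Theory.

Local Open Scope ring_scope.

HB.mixin Record Vector_isLieAlgebra (K : fieldType) L of Vector K L := {
  lie : L -> L -> L;
  lie_linearl : forall y, linear (lie^~ y);
  lie_linearr : forall x, linear (lie x);
  liexx : forall x, lie x x = 0;
  lie_jacobi : forall x y z,
    lie x (lie y z) + lie y (lie z x) + lie z (lie x y) = 0
}.

#[short(type="lieAlgType")]
HB.structure Definition LieAlgebra (K : fieldType) :=
  { L of Vector K L & Vector_isLieAlgebra K L }.

Section LieAlgebraTheory.
Variables (K : fieldType) (L : lieAlgType K).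
Implicit Types (x y : L) (U V W : {vspace L}).

HB.instance Definition _ x :=
  GRing.isSemilinear.Build K L L _ (lie x)
    (GRing.semilinear_linear (lie_linearr x)).

Definition lier y x := lie x y.
HB.instance Definition _ y :=
  GRing.isSemilinear.Build K L L _ (lier y)
    (GRing.semilinear_linear (lie_linearl y)).

(* Taking brackets of basis vectors only is justified by lievP. *)
Definition liev U V : {vspace L} :=
  <<[seq lie u v | u <- vbasis U, v <- vbasis V]>>%VS.

Lemma lievP U V W :
  reflect (forall u v, u \in U -> v \in V -> lie u v \in W) (liev U V <= W)%VS.
Proof.
apply: (iffP idP) => [sUVW u v uU vV|UVW].
  rewrite (coord_vbasis uU) (coord_vbasis vV) -/(lier _ _) linear_sum.
  apply: memv_suml => i _; rewrite linearZ memvZ //= /lier linear_sum.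
  apply: memv_suml => j _; rewrite linearZ memvZ //=.
  apply: (subvP sUVW); apply/memv_span/allpairsP.
  by exists ((vbasis U)`_i, (vbasis V)`_j); rewrite !mem_nth ?size_tuple.
apply/span_subvP => _ /allpairsP[[u v] /= [uU vV ->]].
by apply: UVW; apply: vbasis_mem.
Qed.

Definition lower_central (i : nat) : {vspace L} := iter i (liev fullv) fullv.

Definition nilpotent_of_step (r : nat) : Prop :=
  [/\ (0 < r)%N, lower_central r = 0%VS & lower_central r.-1 <> 0%VS].

(* U :\: V is a complement of U :&: V in U, so here its dimension is that
   of the quotient U / V. *)
Definition has_type (s : seq nat) : Prop :=
  nilpotent_of_step (size s) /\
  forall i, (i < size s)%N ->
    nth 0%N s i = \dim (lower_central i :\: lower_central i.+1)%VS.

Definition lie_automorphism (tau : 'End(L)) : Prop :=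
  lker tau = 0%VS /\ forall x y, tau (lie x y) = lie (tau x) (tau y).

End LieAlgebraTheory.

Section Anosov.
Variables (R : rcfType) (L : lieAlgType R).

(* The matrix of tau is taken in the basis vbasis fullv; its complex
   eigenvalues do not depend on this choice. *)
Definition hyperbolic (tau : 'End(L)) : Prop :=
  forall z : R[i],
    eigenvalue (map_mx (real_complex R)
      (passmx.mxof (vbasis {:L}) (vbasis {:L}) tau)) z ->
    `|z| <> 1.

Definition Z_basis (b : (\dim {:L}).-tuple L) : Prop :=
  basis_of fullv b /\
  forall i j k : 'I_(\dim {:L}),
    exists c : int, coord b k (lie b`_i b`_j) = c%:~R.

(* passmx.mxof acts on row vectors: it is the transpose of the usual matrix of tau,
   which does not affect membership in GL_n(Z). *)
Definition anosov : Prop :=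
  exists tau : 'End(L), [/\ lie_automorphism tau, hyperbolic tau &
    exists b : (\dim {:L}).-tuple L, Z_basis b /\
      exists2 A : 'M[int]_(\dim {:L}), A \in unitmx &
        passmx.mxof b b tau = map_mx intr A].

End Anosov.

Section Algebra13.
Variable K : fieldType.

Definition n13 : Type := 'rV[K]_13.
HB.instance Definition _ := Vector.on n13.

(* The basis X_1, ..., X_6, Y_1, Y_2, Y_3, Z_1, Z_2, W_1, W_2 is the
   canonical basis of K^13, in this order; xi i, yi i, zi i, wi i are the
   indices of X_i, Y_i, Z_i, W_i. *)
Definition xi (i : nat) : 'I_13 := inord i.-1.
Definition yi (i : nat) : 'I_13 := inord (5 + i).
Definition zi (i : nat) : 'I_13 := inord (8 + i).
Definition wi (i : nat) : 'I_13 := inord (10 + i).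
Definition Zn (i : nat) : n13 := delta_mx 0 (zi i).
Definition Wn (i : nat) : n13 := delta_mx 0 (wi i).

(* (a, b, v) stands for the relation [e_a, e_b] = v. *)
Definition n13_relations : seq ('I_13 * 'I_13 * n13) :=
  [:: (xi 1, yi 1, Zn 1); (xi 2, yi 2, Zn 2); (xi 3, yi 3, - (Zn 1 + Zn 2));
      (xi 4, yi 1, Wn 1); (xi 5, yi 2, Wn 2); (xi 6, yi 3, - (Wn 1 + Wn 2))].

(* The bilinear alternating extension of these relations, all other brackets
   of basis vectors being zero. *)
Definition n13_lie (u v : n13) : n13 :=
  \sum_(t <- n13_relations)
    (u 0 t.1.1 * v 0 t.1.2 - u 0 t.1.2 * v 0 t.1.1) *: t.2.

Lemma n13_lie_delta (i j : 'I_13) :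
  n13_lie (delta_mx 0 i) (delta_mx 0 j) =
  \sum_(t <- n13_relations)
    (((i, j) == t.1)%:R - ((j, i) == t.1)%:R) *: t.2.
Proof.
apply: eq_bigr => -[[a b] v] _ /=; rewrite !mxE !eqxx /= -!natrM !mulnb.
by rewrite !xpair_eqE ![_ == i]eq_sym ![_ == j]eq_sym [(i == b) && _]andbC.
Qed.

Fact n13_lie_linearl v : linear (n13_lie^~ v).
Proof.
move=> a x y; rewrite /n13_lie scaler_sumr -big_split /=.
apply: eq_bigr => t _; rewrite !mxE scalerA -scalerDl; congr (_ *: _).
by rewrite !mulrDl mulrBr opprD addrACA !mulrA.
Qed.

Fact n13_liexx u : n13_lie u u = 0.
Proof.
by apply: big1_seq => t _; rewrite [X in _ - X]mulrC subrr scale0r.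
Qed.

Fact n13_lieC u v : n13_lie v u = - n13_lie u v.
Proof.
rewrite /n13_lie -sumrN; apply: eq_bigr => t _.
by rewrite -scaleNr opprB mulrC [X in _ - X]mulrC.
Qed.

Fact n13_lie_linearr u : linear (n13_lie u).
Proof.
by move=> a x y; rewrite n13_lieC n13_lie_linearl opprD -scalerN -!n13_lieC.
Qed.

Fact n13_lie_lt9 u v (k : 'I_13) : (k < 9)%N -> n13_lie u v 0 k = 0.
Proof.
move=> k9; rewrite /n13_lie summxE big1_seq // => t /andP[_ tin].
suff -> : t.2 = t.2 *m diag_mx (\row_j (9 <= j)%N%:R).
  by rewrite mxE mul_mx_diag !mxE leqNgt k9 !mulr0.
have zwE c : (9 <= c < 13)%N -> delta_mx 0 (inord c) =
    (delta_mx 0 (inord c) : 'rV[K]_13) *m diag_mx (\row_j (9 <= j)%N%:R).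
  move=> /andP[c9 c13]; apply/rowP => j; rewrite mul_mx_diag !mxE eqxx /=.
  case: eqP => [->|]; last by rewrite mul0r.
  by rewrite inordK // c9 mulr1.
by move: tin; rewrite !inE => /or4P[|||/or3P[]] /eqP-> /=;
  rewrite ?mulNmx ?mulmxDl -!zwE.
Qed.

Fact n13_lie_lie u v w : n13_lie u (n13_lie v w) = 0.
Proof.
apply: big1_seq => t /andP[_ tin].
have [a9 b9] : (t.1.1 < 9)%N /\ (t.1.2 < 9)%N.
  by move: tin; rewrite !inE => /or4P[|||/or3P[]] /eqP-> /=; rewrite !inordK.
by rewrite !n13_lie_lt9 // !mulr0 subrr scale0r.
Qed.

Fact n13_jacobi x y z :
  n13_lie x (n13_lie y z) + n13_lie y (n13_lie z x) + n13_lie z (n13_lie x y)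
  = 0.
Proof. by rewrite !n13_lie_lie !addr0. Qed.

HB.instance Definition _ := Vector_isLieAlgebra.Build K n13
  n13_lie_linearl n13_lie_linearr n13_liexx n13_jacobi.

End Algebra13.

(* Main.v *)
Require Import Defs.
From mathcomp Require Import all_boot all_order all_algebra.
From mathcomp Require Import reals.
From mathcomp Require Import complex ring lra.

(** Let F = Q(2 cos(2 pi / 7)) be the totally real cubic field of
    t^3 + t^2 - 2 t - 1 and let p^2 = p + 1.  Identifying R^3 with F ⊗ R, the
    algebra is X = F ⊗ Z[p], Y = F, [n, n] = (F / Q) ⊗ Z[p] tensored with the
    reals, the bracket being multiplication in F followed by the projection
    modulo Q.  The automorphism multiplies X by t p, Y by t^-1 and [n, n] by p:
    the units t and t^-1 cancel in the bracket, so the automorphism acts on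
    [n, n] only through p and the non-invariance of Q under t does not matter.
    It preserves the lattice spanned by the monomials t^k p^l, as does its
    inverse, and its eigenvalues are the numbers t_i p_j, 1 / t_i and p_j. *)

Set Implicit Arguments.
Unset Strict Implicit.
Unset Printing Implicit Defensive.

Import Order.TTheory GRing.Theory Num.Theory.

Local Open Scope ring_scope.

(** * The bracket in explicit coordinates *)

Section Coordinates.
Variable K : fieldType.

(* Entries missing from s are read as 0. *)
Definition row13 (s : seq K) : n13 K := \row_j s`_j.

Lemma row13E s i : (i < 13)%N -> row13 s 0 (inord i) = s`_i.
Proof. by move=> i13; rewrite mxE inordK. Qed.

Lemma n13P (u v : n13 K) :
  (forall i, (i < 13)%N -> u 0 (inord i) = v 0 (inord i)) -> u = v.
Proof. by move=> uv; apply/rowP => j; have := uv j (ltn_ord j); rewrite inord_val. Qed.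

Lemma delta13E a i : (a < 13)%N -> (i < 13)%N ->
  (delta_mx 0 (inord a) : n13 K) 0 (inord i) = (i == a)%:R.
Proof. by move=> a13 i13; rewrite mxE eqxx -val_eqE /= !inordK. Qed.

(** With every coordinate of a bracket in closed form, bracket identities reduce to thirteen scalar
    identities for [ring]. *)
Lemma n13_lieE (u v : n13 K) :
  lie u v =
  let c i j := u 0 (inord i) * v 0 (inord j) - u 0 (inord j) * v 0 (inord i) in
  row13 [:: 0; 0; 0; 0; 0; 0; 0; 0; 0;
            c 0%N 6%N - c 2%N 8%N; c 1%N 7%N - c 2%N 8%N;
            c 3%N 6%N - c 5%N 8%N; c 4%N 7%N - c 5%N 8%N].
Proof.
apply: n13P => i i13; rewrite row13E // summxE.
rewrite /n13_relations !big_cons big_nil /= /Zn /Wn /zi /wi /xi /yi.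
rewrite -![(5 + 1)%N]/6%N -![(5 + 2)%N]/7%N -![(5 + 3)%N]/8%N -![(8 + 1)%N]/9%N.
rewrite -![(8 + 2)%N]/10%N -![(10 + 1)%N]/11%N -![(10 + 2)%N]/12%N /=.
have dE a : (a < 13)%N -> (delta_mx 0 (inord a) : 'rV[K]_13) 0 (inord i) = (i == a)%:R.
  by move=> a13; exact: delta13E.
have sE (a : K) (M : 'rV[K]_13) j : (a *: M) 0 j = a * M 0 j by rewrite mxE.
have nE (M : 'rV[K]_13) j : (- M) 0 j = - M 0 j by rewrite mxE.
have aE (M N : 'rV[K]_13) j : (M + N) 0 j = M 0 j + N 0 j by rewrite mxE.
rewrite !(sE, nE, aE) !dE // {dE sE nE aE}.
by move: i i13; do 13!(case=> [_ /=|]; first by rewrite ?eqE /=; ring).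
Qed.

End Coordinates.

(** * Descending central series, nilpotency step and type *)

Section LowerCentral.
Variable K : fieldType.

(** The index pairs of the relations are distinct and none is the reverse of another, so only the
    term of [t] itself survives in the sum. *)
Lemma lie_relation t : t \in n13_relations K ->
  lie (delta_mx 0 t.1.1 : n13 K) (delta_mx 0 t.1.2) = t.2.
Proof.
move=> tin; rewrite [LHS]n13_lie_delta -surjective_pairing.
move: tin; rewrite !inE => /or4P[|||/or3P[]] /eqP -> /=;
  rewrite /n13_relations !big_cons big_nil /= !xpair_eqE -!val_eqE /= !inordK //=;
  by rewrite ?(subrr, subr0, scale0r, scale1r, add0r, addr0).
Qed.

Definition derived13_basis : 4.-tuple (n13 K) :=
  [tuple Zn K 1; Zn K 2; Wn K 1; Wn K 2].

Lemma derived13_free : free derived13_basis.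
Proof.
apply/freeP => k; rewrite !big_ord_recl big_ord0 => sum0.
have cE i : (i < 13)%N -> _ := fun i13 => congr1 (fun v : n13 K => v 0 (inord i)) sum0.
have := (cE 9%N isT, cE 10%N isT, cE 11%N isT, cE 12%N isT).
rewrite /tnth /= /Zn /Wn /zi /wi !mxE !eqxx -!val_eqE /= !inordK //=.
rewrite !(mulr0, mulr1, addr0, add0r) => -[[[k0 k1] k2] k3].
case; case=> [i4|[i4|[i4|[i4|//]]]].
- by rewrite -k0; congr k; apply: val_inj.
- by rewrite -k1; congr k; apply: val_inj.
- by rewrite -k2; congr k; apply: val_inj.
- by rewrite -k3; congr k; apply: val_inj.
Qed.

(** A bracket is by definition a combination of right-hand sides of relations; conversely each of
    the four vectors is itself such a right-hand side. *)
Lemma lower_central1 : lower_central (n13 K) 1 = <<derived13_basis>>%VS.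
Proof.
apply/eqP; rewrite eqEsubv /lower_central /=; apply/andP; split.
  have [Z1 Z2 W1 W2] : [/\ Zn K 1 \in <<derived13_basis>>%VS,
      Zn K 2 \in <<derived13_basis>>%VS, Wn K 1 \in <<derived13_basis>>%VS &
      Wn K 2 \in <<derived13_basis>>%VS].
    by split; apply: memv_span; rewrite !inE eqxx ?orbT.
  apply/lievP => u v _ _; rewrite /lie /= /n13_lie.
  rewrite /n13_relations !big_cons big_nil /= addr0.
  do !apply: memvD; apply: memvZ; rewrite ?memvN ?memvD //.
have in_liev t : t \in n13_relations K -> t.2 \in liev (fullv : {vspace n13 K}) fullv.
  move/lie_relation <-.
  by move/lievP: (subvv (liev (fullv : {vspace n13 K}) fullv)); apply; apply: memvf.
apply/span_subvP => v; rewrite !inE => /or4P[] /eqP ->.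
- by apply: (in_liev (xi 1, yi 1, Zn K 1)); rewrite !inE eqxx ?orbT.
- by apply: (in_liev (xi 2, yi 2, Zn K 2)); rewrite !inE eqxx ?orbT.
- by apply: (in_liev (xi 4, yi 1, Wn K 1)); rewrite !inE eqxx ?orbT.
- by apply: (in_liev (xi 5, yi 2, Wn K 2)); rewrite !inE eqxx ?orbT.
Qed.

Lemma dim_lower_central1 : \dim (lower_central (n13 K) 1) = 4%N.
Proof. by rewrite lower_central1; apply/eqP/derived13_free. Qed.

Lemma lower_central2 : lower_central (n13 K) 2 = 0%VS.
Proof.
apply/eqP; rewrite -subv0; apply/lievP => u v _ vC1.
rewrite memv0; apply/eqP.
(* The kernel of the adjoint map of [u] is a subspace, so containing all brackets is enough for it
   to contain their span. *)
suff /subvP/(_ v vC1) : (lower_central (n13 K) 1 <= lker (linfun (lie u)))%VS.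
  by rewrite memv_ker lfunE => /eqP.
by apply/lievP => x y _ _; rewrite memv_ker lfunE; apply/eqP/n13_lie_lie.
Qed.

Lemma nilpotent_n13 : nilpotent_of_step (n13 K) 2.
Proof.
split=> //; first exact: lower_central2.
by move=> C1; have := dim_lower_central1; rewrite C1 dimv0.
Qed.

Lemma dim_n13 : \dim {:n13 K} = 13%N.
Proof. exact: dimvf. Qed.

Lemma type_n13 : has_type (n13 K) [:: 9; 4]%N.
Proof.
split=> [|[|[|//]] _]; first exact: nilpotent_n13.
  (* The dimensions of intersection and complement add up: 4 + 9 = 13. *)
  have := dimv_cap_compl (lower_central (n13 K) 0) (lower_central (n13 K) 1).
  by rewrite capfv dim_lower_central1 [X in _ = X]dim_n13 => -[].
have := dimv_cap_compl (lower_central (n13 K) 1) (lower_central (n13 K) 2).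
by rewrite {1}lower_central2 capv0 dimv0 dim_lower_central1.
Qed.

End LowerCentral.

(** * Criteria for hyperbolicity and for the Anosov property *)

Section AnosovCriterion.
Variable R : realType.

(** A change of basis from [vbasis fullv] to the canonical one turns a complex eigenvector into an
    eigenvector of [diag_mx d], so each eigenvalue is one of the real entries of [d]. *)
Lemma hyperbolic_diag (tau : 'End(n13 R)) (d : 'rV[R]_13) :
  (forall u j, tau u 0 j = u 0 j * d 0 j) -> (forall j, `|d 0 j| != 1) ->
  hyperbolic tau.
Proof.
move=> tauE d_neq1 z /eigenvalueP[v vM v0].
set e := vbasis {:n13 R} in vM.
have e_basis : basis_of fullv e := vbasisP _.
set M := passmx.mxof e e tau in vM.
(* The change of basis matrix; its two dimensions are not convertible, so [row_free] plays the part
   of invertibility. *)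
pose P : 'M[R]_(\dim {:n13 R}, 13) := \matrix_i (e`_i : 'rV[R]_13).
have vecofE u : passmx.vecof e u = u *m P.
  rewrite mulmx_sum_row; apply: eq_bigr => i _; rewrite rowK //.
have MP : M *m P = P *m diag_mx d.
  apply/row_matrixP => i; rewrite !row_mul -vecofE rowE -passmx.hom_vecof //.
  by rewrite passmx.vecof_delta rowK; apply/rowP => j; rewrite mul_mx_diag mxE tauE.
have P_free : row_free P.
  rewrite -kermx_eq0; apply/rowV0P => u /sub_kermxP; rewrite -vecofE => /eqP.
  by rewrite passmx.vecof_eq0 // => /eqP.
pose f := real_complex R : {rmorphism R -> R[i]}.
have Pf_free : row_free (map_mx f P) by rewrite row_free_map.
have w0 : v *m map_mx f P != 0.
  apply: contra v0 => /eqP wP0; apply/eqP.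
  by apply: (row_free_inj Pf_free); rewrite mul0mx.
have [j wj] : exists j, (v *m map_mx f P) 0 j != 0 by apply/rV0Pn.
have : v *m map_mx f P *m map_mx f (diag_mx d) = z *: (v *m map_mx f P).
  by rewrite -mulmxA -map_mxM -MP map_mxM mulmxA vM scalemxAl.
(* Comparing coordinates at [j], where the eigenvector is nonzero, gives [z] equal to the real
   number [d 0 j]. *)
move: (v *m _) wj => w wj /rowP/(_ j).
rewrite map_diag_mx mul_mx_diag !mxE mulrC => /(mulIf wj) <-.
rewrite normc_def /= expr0n addr0 sqrtr_sqr => -[dj].
by have := d_neq1 j; rewrite dj eqxx.
Qed.

Section Lattice.
Variables (L : lieAlgType R) (n : nat) (b : n.-tuple L).

(** For a basis [b], this is membership in its Z-span. *)
Definition lattice (v : L) := forall k, coord b k v \is a Num.int.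

Lemma latticeD u v : lattice u -> lattice v -> lattice (u + v).
Proof. by move=> bu bv k; rewrite linearD rpredD ?bu ?bv. Qed.

Lemma latticeN v : lattice v -> lattice (- v).
Proof. by move=> bv k; rewrite linearN rpredN bv. Qed.

Lemma lattice0 : lattice 0.
Proof. by move=> k; rewrite linear0 rpred0. Qed.

Lemma lattice_mem v : free b -> v \in tval b -> lattice v.
Proof.
move=> b_free /(nthP 0)[i ib <-] k; rewrite size_tuple in ib.
by rewrite (coord_free (Ordinal ib)).
Qed.

End Lattice.

(** If both [tau] and its inverse preserve the lattice, their integer matrices are mutually inverse,
    so no determinant has to be computed. The length [n] is free so that a tuple of explicit length
    can be supplied. *)
Lemma anosov_lattice (L : lieAlgType R) n (b : n.-tuple L) (tau sigma : 'End(L)) :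
  lie_automorphism tau -> hyperbolic tau -> cancel tau sigma -> basis_of fullv b ->
  (forall u v, u \in tval b -> v \in tval b -> lattice b (lie u v)) ->
  (forall v, v \in tval b -> lattice b (tau v)) ->
  (forall v, v \in tval b -> lattice b (sigma v)) -> anosov L.
Proof.
move=> tauA tauH sigmaK b_basis; have dimL : n = \dim {:L}.
  by rewrite -(size_basis b_basis).
rewrite /lattice; move: b b_basis; rewrite dimL => b b_basis lieb taub sigmab.
have b_free := basis_free b_basis.
have mem_b (i : 'I_(\dim {:L})) : b`_i \in tval b by rewrite mem_nth ?size_tuple.
(* Entrywise floor produces the integer matrix; it changes nothing on integral entries. *)
have floor_mx (phi : 'End(L)) :
    (forall v, v \in tval b -> forall k, coord b k (phi v) \is a Num.int) ->
    passmx.mxof b b phi = map_mx intr (map_mx Num.floor (passmx.mxof b b phi)).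
  move=> phib; apply/matrixP => i j; rewrite !mxE /= passmx.vecof_delta.
  by rewrite floorK ?phib.
exists tau; split=> //; exists b; split.
  split=> // i j k; have /intrP[c ->] := lieb _ _ (mem_b i) (mem_b j) k.
  by exists c.
exists (map_mx Num.floor (passmx.mxof b b tau)); last exact: floor_mx.
suff /mulmx1_unit[] : map_mx Num.floor (passmx.mxof b b tau) *m
    map_mx Num.floor (passmx.mxof b b sigma) = 1%:M by [].
(* The product is computed over [R] and the identity is brought back to the integers by
   injectivity. *)
have intr_mx_inj : injective (map_mx intr : 'M[int]_(\dim {:L}) -> 'M[R]__).
  move=> M N /matrixP MN; apply/matrixP => i j; apply: (@intr_inj R).
  by have := MN i j; rewrite !mxE.
apply: intr_mx_inj; rewrite map_mxM map_mx1 -!floor_mx //.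
rewrite -passmx.mxof_comp // -(passmx.mxof1 b_free); congr passmx.mxof.
by apply/lfunP => v; rewrite comp_lfunE /= id_lfunE sigmaK.
Qed.

End AnosovCriterion.

(** * Real roots of the two polynomials, and Vandermonde systems *)

Section Roots.
Variable R : realType.

(** Solved for the leading power, so that the equation can be used to rewrite high powers of t as
    integral combinations of lower ones. *)
Definition cubic_root (t : R) := t ^+ 3 = - t ^+ 2 + t *+ 2 + 1.
Definition golden_root (p : R) := p ^+ 2 = p + 1.

Lemma cubic_ivt (a b : R) : a <= b ->
  (a ^+ 3 + a ^+ 2 - a *+ 2 - 1) * (b ^+ 3 + b ^+ 2 - b *+ 2 - 1) <= 0 ->
  exists2 t, a <= t <= b & cubic_root t.
Proof.
move=> le_ab sgn_ab.
pose q : {poly R} := 'X^3 + 'X^2 - 'X *+ 2 - 1.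
have qE x : q.[x] = x ^+ 3 + x ^+ 2 - x *+ 2 - 1 by rewrite /q !hornerE.
have root_q x : q.[x] = 0 -> cubic_root x by rewrite qE /cubic_root => ?; lra.
have [qa|qa] := lerP q.[a] 0.
  have [qb|qb] := lerP 0 q.[b].
    have [|t tab /eqP/root_q tr] := @poly_ivt _ q a b le_ab; first by rewrite qa.
    by exists t.
  (* Here q(a) <= 0 and q(b) < 0, so the sign hypothesis forces q(a) = 0. *)
  exists a; first by rewrite lexx.
  by apply: root_q; rewrite -!qE in sgn_ab; nra.
(* Here q(a) > 0, hence q(b) <= 0, and the intermediate value theorem applies to -q. *)
have [|t tab /eqP] := @poly_ivt _ (- q) a b le_ab.
  by rewrite !hornerN -!qE in sgn_ab *; apply/andP; split; nra.
by rewrite hornerN => qt; exists t => //; apply: root_q; lra.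
Qed.

Lemma golden_ivt : exists2 p : R, 16 / 10 <= p <= 17 / 10 & golden_root p.
Proof.
have [||p pab /eqP] := @poly_ivt R ('X^2 - 'X - 1) (16 / 10) (17 / 10); rewrite ?hornerE; first lra.
  by apply/andP; split; lra.
by move=> pr; exists p => //; rewrite /golden_root; lra.
Qed.

Lemma vandermonde2 (x y a b : R) : x != y ->
  a + b * x = 0 -> a + b * y = 0 -> a = 0 /\ b = 0.
Proof.
rewrite -subr_eq0 => xy ax ay.
have b0 : b = 0 by apply: (mulIf xy); lra.
by split=> //; rewrite b0 in ax; lra.
Qed.

(** Divided differences: subtracting two equations and cancelling the difference of their nodes
    lowers the degree. *)
Lemma vandermonde3 (x y z a b c : R) : x != y -> x != z -> y != z ->
  a + b * x + c * x ^+ 2 = 0 -> a + b * y + c * y ^+ 2 = 0 ->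
  a + b * z + c * z ^+ 2 = 0 -> [/\ a = 0, b = 0 & c = 0].
Proof.
move=> xy xz yz ax ay az.
have xy0 : b + c * x + c * y = 0.
  by apply: (mulIf (_ : x - y != 0)); rewrite ?subr_eq0 //; lra.
have xz0 : b + c * x + c * z = 0.
  by apply: (mulIf (_ : x - z != 0)); rewrite ?subr_eq0 //; lra.
have c0 : c = 0 by apply: (mulIf (_ : y - z != 0)); rewrite ?subr_eq0 //; lra.
have b0 : b = 0 by rewrite c0 in xy0; lra.
by split=> //; rewrite b0 c0 in ax; lra.
Qed.

Lemma normr_neq1 (x : R) : x != 1 -> x != -1 -> `|x| != 1.
Proof. by move=> x1 xN1; rewrite eqr_norml ler01 andbT negb_or x1. Qed.

End Roots.

(** * The integral lattice and its hyperbolic automorphism *)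

Section CubicLattice.
Variables (R : realType) (t0 t1 t2 p0 p1 : R).
Hypotheses (ct0 : cubic_root t0) (ct1 : cubic_root t1) (ct2 : cubic_root t2).
Hypotheses (gp0 : golden_root p0) (gp1 : golden_root p1).
Hypotheses (t01 : t0 != t1) (t02 : t0 != t2) (t12 : t1 != t2) (p01 : p0 != p1).

(* Xvec f, Yvec g and Zvec f are the elements f(t, p) of F ⊗ Z[p], g(t) of F and
   f(t, p) of (F / Q) ⊗ Z[p], given by their values at the roots t_i and p_j;
   since Z_3 = - (Z_1 + Z_2), the value at t_2 is subtracted in Zvec. *)
Definition Xvec (f : R -> R -> R) : n13 R :=
  row13 [:: f t0 p0; f t1 p0; f t2 p0; f t0 p1; f t1 p1; f t2 p1].
Definition Yvec (g : R -> R) : n13 R :=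
  row13 [:: 0; 0; 0; 0; 0; 0; g t0; g t1; g t2].
Definition Zvec (f : R -> R -> R) : n13 R :=
  row13 [:: 0; 0; 0; 0; 0; 0; 0; 0; 0; f t0 p0 - f t2 p0; f t1 p0 - f t2 p0;
            f t0 p1 - f t2 p1; f t1 p1 - f t2 p1].

Definition monom (k l : nat) (t p : R) : R := t ^+ k * p ^+ l.
Definition power (k : nat) (t : R) : R := t ^+ k.

(** Monomials of degree at most 2 in t and at most 1 in p; the degree 0 in t is absent from the last
    four vectors because it dies in F / Q. *)
Definition cubic_basis : 13.-tuple (n13 R) :=
  [tuple Xvec (monom 0 0); Xvec (monom 1 0); Xvec (monom 2 0);
         Xvec (monom 0 1); Xvec (monom 1 1); Xvec (monom 2 1);
         Yvec (power 0); Yvec (power 1); Yvec (power 2);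
         Zvec (monom 1 0); Zvec (monom 2 0); Zvec (monom 1 1); Zvec (monom 2 1)].

(** The relations for X_3 and X_6 subtract the product at [t2], which is exactly the reduction
    modulo Q made by [Zvec]. *)
Lemma lie_XY f g : lie (Xvec f) (Yvec g) = Zvec (fun t p => f t p * g t).
Proof.
rewrite n13_lieE; apply: n13P => i i13; rewrite /= !row13E //.
by move: i i13; do 13!(case=> [_ /=|]; first by ring).
Qed.

Lemma lie_XX f g : lie (Xvec f) (Xvec g) = 0.
Proof.
rewrite n13_lieE; apply: n13P => i i13; rewrite /= !row13E // [RHS]mxE.
by move: i i13; do 13!(case=> [_ /=|]; first by ring).
Qed.

Lemma lie_YY f g : lie (Yvec f) (Yvec g) = 0.
Proof.
rewrite n13_lieE; apply: n13P => i i13; rewrite /= !row13E // [RHS]mxE.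
by move: i i13; do 13!(case=> [_ /=|]; first by ring).
Qed.

Lemma lie_Zr f u : lie u (Zvec f) = 0.
Proof.
rewrite n13_lieE; apply: n13P => i i13; rewrite /= !row13E // [RHS]mxE.
by move: i i13; do 13!(case=> [_ /=|]; first by ring).
Qed.

Lemma lie_opp (u v : n13 R) : lie v u = - lie u v.
Proof. exact: n13_lieC. Qed.

(** Stands in for congruence modulo the two defining polynomials, since the vectors see only values
    at roots. *)
Definition roots_eq (f g : R -> R -> R) :=
  forall t p, cubic_root t -> golden_root p -> f t p = g t p.

Lemma eq_Xvec f g : roots_eq f g -> Xvec f = Xvec g.
Proof. by move=> fg; rewrite /Xvec !fg. Qed.

Lemma eq_Yvec f g : (forall t, cubic_root t -> f t = g t) -> Yvec f = Yvec g.
Proof. by move=> fg; rewrite /Yvec !fg. Qed.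

Lemma eq_Zvec f g : roots_eq f g -> Zvec f = Zvec g.
Proof. by move=> fg; rewrite /Zvec !fg. Qed.

Lemma XvecD f g : Xvec (fun t p => f t p + g t p) = Xvec f + Xvec g.
Proof.
apply: n13P => i i13; rewrite [RHS]mxE !row13E //.
by move: i i13; do 13!(case=> [_ /=|]; first by ring).
Qed.

Lemma XvecN f : Xvec (fun t p => - f t p) = - Xvec f.
Proof.
apply: n13P => i i13; rewrite [RHS]mxE !row13E //.
by move: i i13; do 13!(case=> [_ /=|]; first by ring).
Qed.

Lemma YvecD f g : Yvec (fun t => f t + g t) = Yvec f + Yvec g.
Proof.
apply: n13P => i i13; rewrite [RHS]mxE !row13E //.
by move: i i13; do 13!(case=> [_ /=|]; first by ring).
Qed.

Lemma YvecN f : Yvec (fun t => - f t) = - Yvec f.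
Proof.
apply: n13P => i i13; rewrite [RHS]mxE !row13E //.
by move: i i13; do 13!(case=> [_ /=|]; first by ring).
Qed.

Lemma ZvecD f g : Zvec (fun t p => f t p + g t p) = Zvec f + Zvec g.
Proof.
apply: n13P => i i13; rewrite [RHS]mxE !row13E //.
by move: i i13; do 13!(case=> [_ /=|]; first by ring).
Qed.

Lemma ZvecN f : Zvec (fun t p => - f t p) = - Zvec f.
Proof.
apply: n13P => i i13; rewrite [RHS]mxE !row13E //.
by move: i i13; do 13!(case=> [_ /=|]; first by ring).
Qed.

(* P abstracts the predicate "the vector attached to f lies in the lattice". *)
Section MonomialInduction.
Variable P : (R -> R -> R) -> Prop.
Hypothesis PD : forall f g, P f -> P g -> P (fun t p => f t p + g t p).
Hypothesis PN : forall f, P f -> P (fun t p => - f t p).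
Hypothesis P_eq : forall f g, roots_eq f g -> P f -> P g.

(** The cubic equation gives a recurrence of order three with integer coefficients, hence an
    induction on three consecutive exponents. *)
Lemma monom_ind_cubic l :
  P (monom 0 l) -> P (monom 1 l) -> P (monom 2 l) -> forall k, P (monom k l).
Proof.
move=> P0 P1 P2 k; suff [] : [/\ P (monom k l), P (monom k.+1 l) & P (monom k.+2 l)] by [].
elim: k => // k [Pk Pk1 Pk2]; split=> //.
apply: P_eq (PD (PD (PN Pk2) (PD Pk1 Pk1)) Pk) => t p ct _.
rewrite /monom; have -> : t ^+ k.+3 = t ^+ k * t ^+ 3 by rewrite -exprD addn3.
by rewrite ct !exprS; ring.
Qed.

Lemma monom_ind_golden k :
  P (monom k 0) -> P (monom k 1) -> forall l, P (monom k l).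
Proof.
move=> P0 P1 l; suff [] : P (monom k l) /\ P (monom k l.+1) by [].
elim: l => // l [Pl Pl1]; split=> //.
apply: P_eq (PD Pl1 Pl) => t p _ gp.
rewrite /monom; have -> : p ^+ l.+2 = p ^+ l * p ^+ 2 by rewrite -exprD addn2.
by rewrite gp !exprS; ring.
Qed.

End MonomialInduction.

(** The coordinates split into an X, a Y and a Z block. Vandermonde systems in the t_i, then in the
    p_j for the X and Z blocks, kill all coefficients. *)
Lemma cubic_basis_free : free cubic_basis.
Proof.
apply/freeP => k0.
pose k m := k0 (inord m).
have k0E i : k0 i = k i by rewrite /k inord_val.
move=> sum0; suff k_eq0 m : (m < 13)%N -> k m = 0 by move=> i; rewrite k0E k_eq0.
(* The same basis as explicit coordinate lists, so that the thirteen scalar equations unfold by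
   computation. *)
pose S : seq (seq R) :=
  let X k l := [:: monom k l t0 p0; monom k l t1 p0; monom k l t2 p0;
                   monom k l t0 p1; monom k l t1 p1; monom k l t2 p1] in
  let Y k := [:: 0; 0; 0; 0; 0; 0; power k t0; power k t1; power k t2] in
  let Z k l := [:: 0; 0; 0; 0; 0; 0; 0; 0; 0;
      monom k l t0 p0 - monom k l t2 p0; monom k l t1 p0 - monom k l t2 p0;
      monom k l t0 p1 - monom k l t2 p1; monom k l t1 p1 - monom k l t2 p1] in
  [:: X 0 0; X 1 0; X 2 0; X 0 1; X 1 1; X 2 1; Y 0; Y 1; Y 2;
      Z 1 0; Z 2 0; Z 1 1; Z 2 1]%N.
have cE j : (j < 13)%N -> \sum_(0 <= m < 13) k m * (nth [::] S m)`_j = 0.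
  move=> j13; rewrite big_mkord.
  have := congr1 (fun v : 'rV[R]_13 => v 0 (inord j)) sum0.
  rewrite summxE [in RHS]mxE => sumj; rewrite -[RHS]sumj; apply: eq_bigr => i _.
  rewrite mxE -k0E; congr (_ * _).
  have -> : cubic_basis`_i = row13 (nth [::] S i).
    by rewrite -(nth_map _ 0) //; congr nth.
  by rewrite row13E.
have := (cE 0%N isT, cE 1%N isT, cE 2%N isT, cE 3%N isT, cE 4%N isT, cE 5%N isT).
have := (cE 6%N isT, cE 7%N isT, cE 8%N isT).
have := (cE 9%N isT, cE 10%N isT, cE 11%N isT, cE 12%N isT).
rewrite unlock /= /monom /power {cE S sum0}.
rewrite !(mulr0, add0r, addr0, expr0, expr1, mulr1, mul1r).
move=> [[[z0 z1] w0] w1] [[y0 y1] y2] [[[[[x0 x1] x2] x3] x4] x5].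
have [k6 k7 k8] : [/\ k 6%N = 0, k 7%N = 0 & k 8%N = 0].
  by apply: (vandermonde3 t01 t02 t12); lra.
(* The Z block gives a t + b t^2 the same value at [t0], [t1] and [t2]; the constant term chosen
   here subtracts the value at [t2], so all three become roots. *)
have [_ a0 a1] : [/\ - ((k 9%N + k 11%N * p0) * t2 + (k 10%N + k 12%N * p0) * t2 ^+ 2) = 0,
    k 9%N + k 11%N * p0 = 0 & k 10%N + k 12%N * p0 = 0].
  by apply: (vandermonde3 t01 t02 t12); lra.
have [_ b0 b1] : [/\ - ((k 9%N + k 11%N * p1) * t2 + (k 10%N + k 12%N * p1) * t2 ^+ 2) = 0,
    k 9%N + k 11%N * p1 = 0 & k 10%N + k 12%N * p1 = 0].
  by apply: (vandermonde3 t01 t02 t12); lra.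
have [c0 c1 c2] : [/\ k 0%N + k 3%N * p0 = 0, k 1%N + k 4%N * p0 = 0 &
    k 2%N + k 5%N * p0 = 0] by apply: (vandermonde3 t01 t02 t12); lra.
have [d0 d1 d2] : [/\ k 0%N + k 3%N * p1 = 0, k 1%N + k 4%N * p1 = 0 &
    k 2%N + k 5%N * p1 = 0] by apply: (vandermonde3 t01 t02 t12); lra.
have [k9 k11] := vandermonde2 p01 a0 b0.
have [k10 k12] := vandermonde2 p01 a1 b1.
have [kk0 kk3] := vandermonde2 p01 c0 d0.
have [kk1 kk4] := vandermonde2 p01 c1 d1.
have [kk2 kk5] := vandermonde2 p01 c2 d2.
by move: m; do 13!(case=> [//|]).
Qed.

Lemma cubic_basisP : basis_of fullv cubic_basis.
Proof. by rewrite basisEfree cubic_basis_free subvf dim_n13 size_tuple. Qed.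

Local Notation int_comb := (lattice cubic_basis).

Lemma lattice_basis v : v \in tval cubic_basis -> int_comb v.
Proof. exact: lattice_mem cubic_basis_free. Qed.

Lemma lattice_X k l : int_comb (Xvec (monom k l)).
Proof.
pose P f := int_comb (Xvec f).
have PD f g : P f -> P g -> P (fun t p => f t p + g t p).
  by rewrite /P XvecD; apply: latticeD.
have PN f : P f -> P (fun t p => - f t p) by rewrite /P XvecN; apply: latticeN.
have P_eq f g : roots_eq f g -> P f -> P g by rewrite /P => /eq_Xvec ->.
by apply: (monom_ind_golden PD P_eq); apply: (monom_ind_cubic PD PN P_eq);
  apply: lattice_basis; rewrite !inE eqxx ?orbT.
Qed.

Lemma lattice_Y k : int_comb (Yvec (power k)).
Proof.
(* The second variable is frozen at a golden root, so that the two-variable induction applies to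
   Y. *)
pose P (f : R -> R -> R) := int_comb (Yvec (f^~ p0)).
have PD f g : P f -> P g -> P (fun t p => f t p + g t p).
  by rewrite /P YvecD; apply: latticeD.
have PN f : P f -> P (fun t p => - f t p) by rewrite /P YvecN; apply: latticeN.
have P_eq f g : roots_eq f g -> P f -> P g.
  by move=> fg; rewrite /P (@eq_Yvec (f^~ p0) (g^~ p0)) // => t ct; apply: fg.
have P_power i : P (monom i 0) <-> int_comb (Yvec (power i)).
  by rewrite /P (@eq_Yvec _ (power i)) // => t _; rewrite /monom mulr1.
apply/P_power/(monom_ind_cubic PD PN P_eq); apply/P_power;
  by apply: lattice_basis; rewrite !inE eqxx ?orbT.
Qed.

Lemma lattice_Z k l : int_comb (Zvec (monom k l)).
Proof.
pose P f := int_comb (Zvec f).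
have PD f g : P f -> P g -> P (fun t p => f t p + g t p).
  by rewrite /P ZvecD; apply: latticeD.
have PN f : P f -> P (fun t p => - f t p) by rewrite /P ZvecN; apply: latticeN.
have P_eq f g : roots_eq f g -> P f -> P g by rewrite /P => /eq_Zvec ->.
(* Monomials constant in t vanish in F / Q; this supplies the base case missing from the basis. *)
have P0 i : P (monom 0 i).
  rewrite /P; suff -> : Zvec (monom 0 i) = 0 by exact: lattice0.
  apply: n13P => j j13; rewrite row13E // [RHS]mxE /monom.
  by move: j j13; do 13!(case=> [_ /=|]; first by ring).
by apply: (monom_ind_golden PD P_eq); apply: (monom_ind_cubic PD PN P_eq) => //;
  apply: lattice_basis; rewrite !inE eqxx ?orbT.
Qed.

Lemma cubic_basis_cases (Q : n13 R -> Prop) :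
  (forall k l, Q (Xvec (monom k l))) -> (forall k, Q (Yvec (power k))) ->
  (forall k l, Q (Zvec (monom k l))) ->
  forall v, v \in tval cubic_basis -> Q v.
Proof.
move=> QX QY QZ v; rewrite !inE.
by do 12!(case/orP=> [/eqP ->|] //); move/eqP ->.
Qed.

Lemma lattice_lie u v : u \in tval cubic_basis -> v \in tval cubic_basis ->
  int_comb (lie u v).
Proof.
have lieXY k l m : int_comb (lie (Xvec (monom k l)) (Yvec (power m))).
  rewrite lie_XY (@eq_Zvec _ (monom (k + m) l)); first exact: lattice_Z.
  by move=> t p _ _; rewrite /monom /power exprD; ring.
move=> ub vb; move: u ub v vb.
apply: cubic_basis_cases => [k l|k|k l]; apply: cubic_basis_cases => [i j|i|i j].
- by rewrite lie_XX; apply: lattice0.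
- exact: lieXY.
- by rewrite lie_Zr; apply: lattice0.
- by rewrite lie_opp; apply/latticeN/lieXY.
- by rewrite lie_YY; apply: lattice0.
- by rewrite lie_Zr; apply: lattice0.
- by rewrite lie_opp lie_Zr oppr0; apply: lattice0.
- by rewrite lie_opp lie_Zr oppr0; apply: lattice0.
- by rewrite lie_Zr; apply: lattice0.
Qed.

(** The inverses of the units t and p as integral polynomials, read off from t (t^2 + t - 2) = 1 and
    p (p - 1) = 1. *)
Definition cubic_inv (t : R) := t ^+ 2 + t - 2.
Definition golden_inv (p : R) := p - 1.

Lemma cubic_invK t : cubic_root t -> t * cubic_inv t = 1.
Proof. by rewrite /cubic_root /cubic_inv => ct; ring: ct. Qed.

Lemma golden_invK p : golden_root p -> p * golden_inv p = 1.
Proof. by rewrite /golden_root /golden_inv => gp; ring: gp. Qed.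

(** Eigenvalues of multiplication by [f], [g] and [h] on the three summands; [h] involves p alone
    because multiplication by t does not descend to F / Q. *)
Definition weights (f : R -> R -> R) (g h : R -> R) : n13 R :=
  row13 [:: f t0 p0; f t1 p0; f t2 p0; f t0 p1; f t1 p1; f t2 p1;
            g t0; g t1; g t2; h p0; h p0; h p1; h p1].
Definition diag13 (d : n13 R) : 'End(n13 R) :=
  linfun (mulmxr (diag_mx d) : {linear n13 R -> n13 R}).

Lemma diag13E d u j : diag13 d u 0 j = u 0 j * d 0 j.
Proof. by rewrite /diag13 lfunE /= mul_mx_diag mxE. Qed.

Lemma diag13_X f g h e :
  diag13 (weights f g h) (Xvec e) = Xvec (fun t p => f t p * e t p).
Proof.
apply: n13P => i i13; rewrite diag13E !row13E //.
by move: i i13; do 13!(case=> [_ /=|]; first by ring).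
Qed.

Lemma diag13_Y f g h e :
  diag13 (weights f g h) (Yvec e) = Yvec (fun t => g t * e t).
Proof.
apply: n13P => i i13; rewrite diag13E !row13E //.
by move: i i13; do 13!(case=> [_ /=|]; first by ring).
Qed.

Lemma diag13_Z f g h e :
  diag13 (weights f g h) (Zvec e) = Zvec (fun t p => h p * e t p).
Proof.
apply: n13P => i i13; rewrite diag13E !row13E //.
by move: i i13; do 13!(case=> [_ /=|]; first by ring).
Qed.

Lemma diag13_lie f g h :
  (forall t p, cubic_root t -> golden_root p -> f t p * g t = h p) ->
  forall u v, let tau := diag13 (weights f g h) in
    tau (lie u v) = lie (tau u) (tau v).
Proof.
move=> fgh u v tau; rewrite !n13_lieE; apply: n13P => i i13.
rewrite [LHS]diag13E /= !diag13E !row13E //.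
have := (fgh _ _ ct0 gp0, fgh _ _ ct1 gp0, fgh _ _ ct2 gp0).
have := (fgh _ _ ct0 gp1, fgh _ _ ct1 gp1, fgh _ _ ct2 gp1).
move=> [[e0 e1] e2] [[e3 e4] e5].
move: i i13; do 9!(case=> [_ /=|]; first by ring).
(* A coordinate of a bracket is a difference of two products, at t_i and at [t2], so the two copies
   of [h] are factored differently. *)
case=> [_ /=|]; first by rewrite mulrBl -{1}e3 -e5; ring.
case=> [_ /=|]; first by rewrite mulrBl -{1}e4 -e5; ring.
case=> [_ /=|]; first by rewrite mulrBl -{1}e0 -e2; ring.
case=> [_ /=|]; first by rewrite mulrBl -{1}e1 -e2; ring.
by [].
Qed.

Lemma diag13K f g h f' g' h' :
  (forall t p, cubic_root t -> golden_root p -> f t p * f' t p = 1) ->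
  (forall t, cubic_root t -> g t * g' t = 1) ->
  (forall p, golden_root p -> h p * h' p = 1) ->
  cancel (diag13 (weights f g h)) (diag13 (weights f' g' h')).
Proof.
move=> ff' gg' hh' u; apply: n13P => i i13; rewrite !diag13E -mulrA.
rewrite -[RHS]mulr1; congr (_ * _); rewrite !row13E //.
by move: i i13; do 13!(case=> [_ /=|]; first by rewrite ?ff' ?gg' ?hh').
Qed.

Lemma anosov_cubic :
  (forall t p, t \in [:: t0; t1; t2] -> p \in [:: p0; p1] ->
    [/\ `|t * p| != 1, `|t| != 1 & `|p| != 1]) -> anosov (n13 R).
Proof.
move=> hyp.
pose tau := diag13 (weights (fun t p => t * p) cubic_inv id).
pose sigma := diag13 (weights (fun t p => cubic_inv t * golden_inv p) id golden_inv).
have tauK : cancel tau sigma.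
  apply: diag13K => [t p ct gp|t ct|p gp].
  - by rewrite mulrACA cubic_invK // golden_invK // mulr1.
  - by rewrite mulrC cubic_invK.
  - exact: golden_invK.
(* If the inverse had modulus 1, so would t. *)
have hyp_inv t : cubic_root t -> t \in [:: t0; t1; t2] -> `|cubic_inv t| != 1.
  move=> ct tin; apply/eqP => tinv1; have := cubic_invK ct.
  move/(congr1 (fun x => `|x|)); rewrite normrM tinv1 mulr1 normr1 => t1E.
  by have [_] := hyp t p0 tin (mem_head _ _); rewrite t1E eqxx.
apply: (@anosov_lattice _ _ _ cubic_basis tau sigma) => //.
- split; first by apply/eqP/lker0P/(can_inj tauK).
  by apply: diag13_lie => t p ct _; rewrite mulrAC cubic_invK // mul1r.
- apply: (hyperbolic_diag (d := weights (fun t p => t * p) cubic_inv id)).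
    exact: diag13E.
  move=> j; rewrite -[j]inord_val row13E ?ltn_ord //.
  have tpin : (t0 \in [:: t0; t1; t2]) * (t1 \in [:: t0; t1; t2]) *
      (t2 \in [:: t0; t1; t2]) * (p0 \in [:: p0; p1]) * (p1 \in [:: p0; p1]).
    by rewrite !inE !eqxx !orbT.
  have hypX t p tin pin := let: And3 h _ _ := hyp t p tin pin in h.
  have hypZ t p tin pin := let: And3 _ _ h := hyp t p tin pin in h.
  case: j => m mlt /=; move: m mlt.
  do 6!(case=> [_ /=|]; first by apply: hypX; rewrite tpin).
  do 3!(case=> [_ /=|]; first by apply: hyp_inv; rewrite ?tpin).
  by do 4!(case=> [_ /=|]; first by apply: (hypZ t0); rewrite tpin).
- exact: cubic_basisP.
- exact: lattice_lie.
- apply: cubic_basis_cases => [k l|k|k l]; rewrite ?diag13_X ?diag13_Y ?diag13_Z.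
  + rewrite (@eq_Xvec _ (monom k.+1 l.+1)); first exact: lattice_X.
    by move=> t p _ _; rewrite /monom !exprS; ring.
  + rewrite (@eq_Yvec _ (fun t => power k.+2 t + power k.+1 t + - (power k t + power k t))).
      by rewrite !YvecD YvecN YvecD; do ![apply: latticeD|apply: latticeN|apply: lattice_Y].
    by move=> t _; rewrite /power /cubic_inv !exprS; ring.
  + rewrite (@eq_Zvec _ (monom k l.+1)); first exact: lattice_Z.
    by move=> t p _ _; rewrite /monom !exprS; ring.
- apply: cubic_basis_cases => [k l|k|k l]; rewrite ?diag13_X ?diag13_Y ?diag13_Z.
  (* [m k l] is the monomial multiplied by p^-1 = p - 1; multiplication by t^-1 follows. *)
  + pose m k l t p := monom k l.+1 t p + - monom k l t p.
    have m_int i : int_comb (Xvec (m i l)).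
      by rewrite /m XvecD XvecN; apply: latticeD; [|apply: latticeN]; apply: lattice_X.
    rewrite (@eq_Xvec _ (fun t p => m k.+2 l t p + m k.+1 l t p + - (m k l t p + m k l t p))).
      by rewrite 2!XvecD XvecN XvecD; do ![apply: latticeD|apply: latticeN|apply: m_int].
    by move=> t p _ _; rewrite /m /monom /cubic_inv /golden_inv !exprS; ring.
  + by rewrite (@eq_Yvec _ (power k.+1)); [exact: lattice_Y | move=> t _; rewrite /power exprS].
  + rewrite (@eq_Zvec _ (fun t p => monom k l.+1 t p + - monom k l t p)).
      by rewrite ZvecD ZvecN; apply: latticeD; [|apply: latticeN]; apply: lattice_Z.
    by move=> t p _ _; rewrite /monom /golden_inv !exprS; ring.
Qed.

End CubicLattice.

(** * Numerical location of the roots and conclusion *)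

Lemma anosov_n13 (R : realType) : anosov (n13 R).
Proof.
(* The intervals isolate 2 cos(2 pi / 7), 2 cos(4 pi / 7) and 2 cos(6 pi / 7), about 1.247, -0.445
   and -1.802. *)
have [||t0 /andP[lt0 ut0] ct0] := @cubic_ivt R (12 / 10) (14 / 10); [lra | lra |].
have [||t1 /andP[lt1 ut1] ct1] := @cubic_ivt R (- 5 / 10) (- 4 / 10); [lra | lra |].
have [||t2 /andP[lt2 ut2] ct2] := @cubic_ivt R (- 19 / 10) (- 18 / 10); [lra | lra |].
have [p0 /andP[lp0 up0] gp0] := golden_ivt R.
(* The two roots of p^2 - p - 1 have sum 1. *)
have gp1 : golden_root (1 - p0).
  by rewrite /golden_root sqrrB expr1n gp0; ring.
apply: (anosov_cubic ct0 ct1 ct2 gp0 gp1); try (by apply/eqP => e; lra).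
move=> t p; rewrite !inE => /or3P[] /eqP -> /orP[] /eqP ->.
(* The bounds on the roots suffice; the closest cases are |t0 (1 - p0)| <= 0.98 and |t2 (1 - p0)| >=
   1.08. *)
all: by split; apply: normr_neq1; apply/eqP => e; nra.
Qed.

Local Close Scope ring_scope.

Theorem mainTheorem5 (R : realType) :
  [/\ nilpotent_of_step (n13 R) 2, anosov (n13 R) &
      has_type (n13 R) [:: 9; 4]].
Proof. by split; [exact: nilpotent_n13|exact: anosov_n13|exact: type_n13]. Qed.
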